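(* A tree $T$ is well-forced if and only if performing star removals on $T$ until no more star removals can be performed results in a possibly empty set of copies of $K_2$ (that is, the resulting graph is a possibly empty disjoint union of copies of $K_2$).
   Context: All graphs are finite and simple. Zero forcing: vertices are colored blue or white; the color change rule says that if a blue vertex $v$ has exactly one white neighbor $u$, then $u$ is changed to blue. A set $S\subseteq V(G)$ is a zero forcing set of $G$ if, starting with exactly the vertices of $S$ blue, repeated application of the rule colors all vertices of $G$ blue. A zero forcing set is minimal if the removal of any vertex from it results in a set that is not a zero forcing set; it is minimum if it has the smallest cardinality among all zero forcing sets. A graph is well-forced if every minimal zero forcing set is minimum (equivalently, all minimal zero forcing sets have the same cardinality). For a vertex $v$ of a graph $H$, let $L(v)=N(v)\cap\{u\in V(H):\deg_H(u)=1\}$ and $L[v]=L(v)\cup\{v\}$. A star removal on a tree or forest $H$ consists of choosing a vertex $v$ with $|L(v)|\ge 2$ (computed in $H$) and replacing $H$ by the subgraph induced by $V(H)\setminus L[v]$. Star removals are applied repeatedly, each time to the current graph.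
   Formalization: The tree T is assumed to have at least two vertices: the one-vertex tree is well-forced, but no star removal applies to it and it is not a disjoint union of copies of K_2, so the claim fails for that single tree. *)

(* Defs.v *)
(* A finite simple graph is a symmetric, irreflexive relation
   [E : rel V] on a finite type [V]; an induced subgraph is given by its vertex
   set [H : {set V}], so that degrees and leaves "in H" ignore every vertex
   outside [H]. *)
From mathcomp Require Import all_boot.

Set Implicit Arguments.
Unset Strict Implicit.
Unset Printing Implicit Defensive.

Section Defs.

Variables (V : finType) (E : rel V).

Definition connected_graph : Prop := forall x y : V, connect E x y.

(* [ucycle E c] also holds for sequences of length 0 and, when E is symmetric,
   for the two ends of an edge, hence the bound on the length. *)
Definition acyclic_graph : Prop := forall c : seq V, 2 < size c -> ~ ucycle E c.

Definition is_tree : Prop := [/\ 0 < #|V|, connected_graph & acyclic_graph].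

Definition nbrs (H : {set V}) (v : V) : {set V} := [set u in H | E v u].

Definition color_change : rel {set V} := fun B B' =>
  [exists v in B, exists u, (nbrs (~: B) v == [set u]) && (B' == u |: B)].

Definition zero_forcing (S : {set V}) : bool := connect color_change S [set: V].

Definition minimal_zfs (S : {set V}) : Prop :=
  zero_forcing S /\ forall v : V, v \in S -> ~~ zero_forcing (S :\ v).

Definition minimum_zfs (S : {set V}) : Prop :=
  zero_forcing S /\ forall S' : {set V}, zero_forcing S' -> #|S| <= #|S'|.

Definition well_forced : Prop :=
  forall S : {set V}, minimal_zfs S -> minimum_zfs S.

Definition leaf_nbrs (H : {set V}) (v : V) : {set V} :=
  [set u in nbrs H v | #|nbrs H u| == 1].

Definition star_removal : rel {set V} := fun H H' =>
  [exists v in H, (1 < #|leaf_nbrs H v|) && (H' == H :\: (v |: leaf_nbrs H v))].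

(* [R] is the outcome of some exhaustive sequence of star removals on the
   whole graph; the sequence is not unique. *)
Definition star_removal_result (R : {set V}) : Prop :=
  connect star_removal [set: V] R /\ forall H : {set V}, ~~ star_removal R H.

(* The subgraph induced by [R] is isomorphic to the disjoint union of k copies
   of K_2, on the vertices [(i, b)], where [i : 'I_k] numbers the copies. *)
Definition copies_of_K2 (R : {set V}) : Prop :=
  exists (k : nat) (f : 'I_k * bool -> V),
    [/\ injective f, R = [set f p | p in [set: 'I_k * bool]] &
        forall p q, E (f p) (f q) = (p.1 == q.1) && (p.2 != q.2)].

Lemma star_removal_card H H' : star_removal H H' -> #|H'| < #|H|.
Proof.
case/existsP=> v /and3P[vH _ /eqP->]; apply: proper_card.
by apply/properP; split; [exact: subsetDl | exists v; rewrite // !inE eqxx].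
Qed.

Lemma star_removal_result_exists : exists R, star_removal_result R.
Proof.
have [R cR minR] :=
  @arg_minnP _ [set: V] (connect star_removal [set: V]) (fun H => #|H|)
    (connect0 _ _).
exists R; split=> // H; apply/negP=> RH.
have := minR H (connect_trans cR (connect1 RH)).
by rewrite leqNgt star_removal_card.
Qed.

End Defs.

(* Main.v *)
Require Import Defs.
From mathcomp Require Import all_boot.

Set Implicit Arguments.
Unset Strict Implicit.
Unset Printing Implicit Defensive.

(** The proof replaces the colouring process by its obstructions. A fort of
    [H] is a nonempty set [F] such that no vertex of [H] outside [F] has
    exactly one neighbour in [F]; a fort that is white at the start stays
    white, and the white set of a stalled process is empty or a fort. So [S]
    is zero forcing exactly when it meets every fort ([zero_forcingE]), and
    a graph is well-forced exactly when all its minimal fort transversals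
    have the same size ([well_forcedE]).

    A star removal at [v] does not affect this property ([equiforced_star]).
    Write [L] for the leaves at [v] and [G] for what remains. Two leaves at
    [v] form a fort, so a minimal set [S] misses at most one leaf, and [v]
    is blue for free. If [S] misses one leaf, [v] is used up to force it,
    and [S :&: G] is minimal for [G]. If [S] contains all of [L], minimality
    makes [v] force some neighbour [u] of [v] in [G], and [u |: S :&: G] is
    minimal for [G]; this is where acyclicity enters, since the other
    neighbours of [v] lie in other components of [G] and must turn blue
    there without help from [u]. In both cases the sizes differ by
    [#|L| - 1].

    What is left is a forest [R] with at most one leaf at each vertex, and
    with no isolated vertex, because a vertex losing its last neighbour [v]
    in a star removal was itself a leaf at [v]. If [R] consists of copies of
    [K_2], each minimal set picks one vertex of each copy
    ([equiforced_copies]). Otherwise root every component of [R] and let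
    each vertex with children have a favourite child, a leaf whenever
    possible. The vertices that are not favourites form a minimal zero
    forcing set ([minimal_forcing_tops]): they are the tops of the
    descending paths that follow the favourites. Their number is the number
    of childless vertices. Rooting a component of order at least 3 at a leaf
    instead of at the neighbour of this leaf lowers that number by one, so
    [R] has minimal sets of two sizes ([not_equiforced]). *)

(** * Forts and zero forcing *)

Section Forts.

Variables (V : finType) (E : rel V).
Implicit Types (H F S : {set V}).

Definition fort H F : bool :=
  [&& F != set0, F \subset H & [forall w in H :\: F, #|nbrs E F w| != 1]].

Definition forcing H S : bool :=
  [forall F : {set V}, fort H F ==> ~~ [disjoint S & F]].

Definition minimal_forcing H S : bool :=
  [&& S \subset H, forcing H S & [forall x in S, ~~ forcing H (S :\ x)]].

(** Comparing minimal sets with each other, rather than with a minimum one,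
    gives a condition that transfers symmetrically between two graphs. *)
Definition equiforced H : Prop :=
  forall S S', minimal_forcing H S -> minimal_forcing H S' -> #|S| = #|S'|.

Lemma fortP H F :
  reflect [/\ F != set0, F \subset H &
            forall w f, w \in H -> w \notin F -> f \in F -> E w f ->
              exists g, [/\ g \in F, E w g & g != f]]
          (fort H F).
Proof.
apply: (iffP and3P) => -[F0 FH hF]; split=> //.
  move=> w f wH wF fF wf; have /forall_inP/(_ w) := hF.
  rewrite inE wF wH => /(_ isT) n1.
  case: (pickP [pred g in F | E w g && (g != f)]) => [g /and3P[]|none].
    by exists g; split.
  case/negP: n1; apply/cards1P; exists f; apply/setP=> g; rewrite !inE.
  have := none g; rewrite /=; case: eqP => [->|_]; first by rewrite fF wf.
  by rewrite andbT.
apply/forall_inP => w; rewrite inE => /andP[wF wH].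
apply/negP => /cards1P[f Ef].
have: f \in nbrs E F w by rewrite Ef set11.
rewrite inE => /andP[fF wf].
have [g [gF wg /negP[]]] := hF w f wH wF fF wf.
have: g \in nbrs E F w by rewrite inE gF.
by rewrite Ef inE.
Qed.

Lemma forcingP H S :
  reflect (forall F, fort H F -> exists2 x, x \in S & x \in F) (forcing H S).
Proof.
apply: (iffP forallP) => [hS F fF | hS F].
  have := hS F; rewrite fF /= disjoint_sym => /pred0Pn[x].
  by case/andP=> xF xS; exists x.
apply/implyP => /hS[x xS xF].
by apply/pred0Pn; exists x; rewrite /= xS.
Qed.

Lemma not_forcing H S F :
  fort H F -> (forall x, x \in S -> x \notin F) -> ~~ forcing H S.
Proof.
by move=> fF SF; apply/negP => /forcingP/(_ F fF)[x /SF/negP].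
Qed.

Lemma forcingS H S S' : S \subset S' -> forcing H S -> forcing H S'.
Proof.
move=> /subsetP SS' /forcingP hS; apply/forcingP => F /hS[x xS xF].
by exists x => //; apply: SS'.
Qed.

Lemma fortU H F F' : fort H F -> fort H F' -> fort H (F :|: F').
Proof.
move=> /fortP[F0 FH hF] /fortP[F'0 F'H hF']; apply/fortP; split.
- by apply: contraNneq F0 => FF'; rewrite -subset0 -FF' subsetUl.
- by rewrite subUset FH.
move=> w f wH; rewrite !inE negb_or => /andP[wF wF'] /orP[] fF wf.
  by have [g [gF wg gf]] := hF w f wH wF fF wf; exists g; rewrite inE gF.
by have [g [gF wg gf]] := hF' w f wH wF' fF wf; exists g; rewrite inE gF orbT.
Qed.

Lemma minimal_forcingP H S :
  reflect [/\ S \subset H, forcing H S &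
            forall x, x \in S -> ~~ forcing H (S :\ x)]
          (minimal_forcing H S).
Proof.
by apply: (iffP and3P) => -[SH fS mS]; split=> //; apply/forall_inP.
Qed.

Lemma exists_minimal_forcing H S :
  S \subset H -> forcing H S ->
  exists2 S', minimal_forcing H S' & S' \subset S.
Proof.
move=> SH fS; have [S' /minsetP[fS' mS'] S'S] := minset_exists fS.
exists S' => //; apply/minimal_forcingP; split=> //.
  exact: subset_trans S'S SH.
move=> x xS'; apply/negP => fx; have := mS' _ fx (subsetDl _ _).
by move/setP/(_ x); rewrite !inE eqxx xS'.
Qed.

(** A force never enters a fort that is disjoint from the blue set, and when
    no force is possible the white vertices, if any, form a fort. Every
    reachable blue set of maximal size is such a stalled one. *)
Lemma zero_forcingE S : zero_forcing E S = forcing [set: V] S.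
Proof.
apply/idP/idP => [zS | fS].
  apply/forcingP => F /fortP[/set0Pn[y yF] _ hF].
  case: (boolP [disjoint S & F]) => [dSF | ]; last first.
    by case/pred0Pn => x /andP[xS xF]; exists x.
  suff: [disjoint [set: V] & F].
    by move/pred0P/(_ y); rewrite /= inE yF.
  case/connectP: zS dSF => p pth ->; elim: p S pth => //= B p IHp S.
  case/andP=> /existsP[v /andP[vS /existsP[u /andP[/eqP uq /eqP ->]]]] pth dSF.
  apply: IHp => //; rewrite disjoints_subset subUset -!disjoints_subset dSF.
  rewrite disjoints1 andbT; apply/negP => uF.
  have vF : v \notin F by rewrite (disjointFr dSF).
  have: u \in nbrs E (~: S) v by rewrite uq set11.
  rewrite inE => /andP[uS vu].
  have [g [gF vg /negP[]]] := hF v u (in_setT _) vF uF vu.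
  have: g \in nbrs E (~: S) v by rewrite !inE vg (disjointFl dSF).
  by rewrite uq inE.
have [B cB maxB] := @arg_maxnP _ S (connect (color_change E) S)
  (fun B => #|B|) (connect0 _ _).
have SB : S \subset B.
  case/connectP: cB => p pth ->; elim: p S pth {fS B maxB} => //= B p IHp S.
  case/andP=> /existsP[v /andP[vS /existsP[u /andP[_ /eqP eB]]]] /IHp.
  by apply: subset_trans; rewrite eB subsetUr.
suff eBT : B = [set: V] by rewrite /zero_forcing -eBT.
apply: contraTeq (fS) => BT; suff fB : fort [set: V] (~: B).
  by apply: (not_forcing fB) => x /(subsetP SB); rewrite inE negbK.
apply/and3P; split; rewrite ?subsetT //.
  by apply: contraNneq BT => B0; rewrite -(setCK B) B0 setC0.
apply/forall_inP => w; rewrite !inE negbK andbT => wB.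
apply/negP => /cards1P[u Eu].
have uB : u \notin B.
  have : u \in nbrs E (~: B) w by rewrite Eu set11.
  by rewrite !inE => /andP[].
have cuB : connect (color_change E) S (u |: B).
  apply: connect_trans cB (connect1 _); apply/existsP; exists w; rewrite wB.
  by apply/existsP; exists u; rewrite Eu !eqxx.
by have := maxB _ cuB; rewrite /= cardsU1 uB ltnn.
Qed.

Lemma well_forcedE : well_forced E <-> equiforced [set: V].
Proof.
have mE S : minimal_zfs E S <-> minimal_forcing [set: V] S.
  split=> [[zS mS] | /minimal_forcingP[_ fS mS]].
    apply/minimal_forcingP; split; rewrite ?subsetT -?zero_forcingE //.
    by move=> x /mS; rewrite zero_forcingE.
  by split; rewrite ?zero_forcingE // => x /mS; rewrite zero_forcingE.
split=> [wE S S' mS mS' | wE S /mE mS].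
  have [zS leS] := wE _ ((mE S).2 mS); have [zS' leS'] := wE _ ((mE S').2 mS').
  by apply/eqP; rewrite eqn_leq leS ?leS'.
split=> [|S' zS']; first by rewrite zero_forcingE; case/minimal_forcingP: mS.
rewrite zero_forcingE in zS'.
have [S2 mS2 S2S] := exists_minimal_forcing (subsetT S') zS'.
by rewrite (wE _ _ mS mS2) subset_leq_card.
Qed.

End Forts.

(** * Star removals preserve equal sizes *)

Section StarRemoval.

Variables (V : finType) (E : rel V).
Hypotheses (E_sym : symmetric E) (E_irr : irreflexive E).
Implicit Types (H F S : {set V}).

Lemma leaf_nbrP H v l w :
  l \in leaf_nbrs E H v -> v \in H -> w \in H -> E l w -> w = v.
Proof.
rewrite !inE => /andP[/andP[lH vl] /cards1P[x Ex]] vH wH lw.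
have : v \in nbrs E H l by rewrite inE vH E_sym.
have : w \in nbrs E H l by rewrite inE wH.
by rewrite Ex !inE => /eqP -> /eqP.
Qed.

Lemma fort_center_leaf H F v l :
  fort E H F -> v \in H -> l \in leaf_nbrs E H v -> v \in F -> l \in F.
Proof.
case/fortP=> _ /subsetP FH hF vH lL vF; case: (boolP (l \in F)) => // lF.
have lH : l \in H by move: lL; rewrite !inE => /andP[/andP[]].
have lv : E l v by move: lL; rewrite !inE E_sym => /andP[/andP[]].
have [g [gF lg /eqP[]]] := hF l v lH lF vF lv.
exact: leaf_nbrP lL vH (FH g gF) lg.
Qed.

Definition induced (G : {set V}) : rel V :=
  fun x y => [&& E x y, x \in G & y \in G].

(** A path between the two neighbours that avoids [v] would close a cycle
    through [v]. *)
Lemma nbrs_disconnected (G : {set V}) v u u' :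
  acyclic_graph E -> v \notin G -> u \in G -> E v u -> E v u' -> u != u' ->
  ~~ connect (induced G) u u'.
Proof.
move=> acE vG uG vu vu' uu'; apply/negP => /connectP[p pth eu'].
case/shortenP: pth eu' => q pth uq _ eu'.
have qG : {subset q <= G}.
  move: pth {uq eu'}; elim: q u {vu uu' uG} => //= x q IHq u.
  case/andP=> /and3P[_ _ xG].
  by move=> /IHq qG y; rewrite inE => /predU1P[->|/qG].
apply: (acE [:: v, u & q]).
  by case: q {pth uq qG} eu' => //= eu'; rewrite eu' eqxx in uu'.
rewrite /ucycle cons_uniq uq andbT; apply/andP; split.
  rewrite /= vu rcons_path -eu' E_sym vu' andbT.
  by apply: sub_path pth => x y /andP[].
by rewrite inE negb_or (contraNneq _ vG) => [|->//]; apply: contra vG => /qG.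
Qed.

Section OneStar.

Variables (H : {set V}) (v : V).
Hypotheses (vH : v \in H) (L2 : 1 < #|leaf_nbrs E H v|).
Let L := leaf_nbrs E H v.
Let G := H :\: (v |: L).

Let LH l : l \in L -> l \in H. Proof. by rewrite !inE => /andP[/andP[]]. Qed.
Let vL l : l \in L -> E v l. Proof. by rewrite !inE => /andP[/andP[]]. Qed.
Let Lv l w : l \in L -> w \in H -> E l w -> w = v.
Proof. by move=> lL wH; apply: leaf_nbrP lL vH wH. Qed.
Let vNL : v \notin L. Proof. by apply/negP => /vL; rewrite E_irr. Qed.
Let GE x : x \in G = [&& x != v, x \notin L & x \in H].
Proof. by rewrite !inE negb_or andbA. Qed.
Let GH : G \subset H. Proof. exact: subsetDl. Qed.
Let GL w l : w \in G -> l \in L -> ~~ E w l.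
Proof.
by rewrite GE E_sym => /and3P[wv _ wH] lL; apply: contraNN wv => /Lv->.
Qed.
Let other_leaf l : exists2 l', l' \in L & l' != l.
Proof.
have : 0 < #|L :\ l|.
  by have := L2; rewrite -/L (cardsD1 l L); case: (l \in L) => // /ltnW.
by rewrite card_gt0 => /set0Pn[l']; rewrite in_setD1 => /andP[]; exists l'.
Qed.

Lemma fort_avoiding_star F : fort E H F -> F \subset G -> fort E G F.
Proof.
case/fortP=> F0 FH hF FG; apply/fortP; split=> // w f wG.
by apply: hF; apply: (subsetP GH).
Qed.

Lemma fort_of_remaining F :
  fort E G F -> #|nbrs E F v| != 1 -> fort E H F.
Proof.
case/fortP=> F0 FG hF nv.
apply/and3P; split; rewrite ?(subset_trans FG GH) //; apply/forall_inP => w.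
rewrite inE => /andP[wF wH]; case: (eqVneq w v) => [->//|wv].
apply/negP => /cards1P[f Ef].
have : f \in nbrs E F w by rewrite Ef set11.
rewrite inE => /andP[fF wf]; have fG := subsetP FG _ fF.
case: (boolP (w \in L)) => [wL|wL].
  by have := GL fG wL; rewrite E_sym wf.
have wG : w \in G by rewrite GE wv wL.
have [g [gF wg /negP[]]] := hF w f wG wF fF wf.
have : g \in nbrs E F w by rewrite inE gF.
by rewrite Ef inE.
Qed.

Lemma fort_two_leaves l l' : l \in L -> l' \in L -> l != l' ->
  fort E H [set l; l'].
Proof.
move=> lL l'L ll'; apply/fortP; split.
- by apply/set0Pn; exists l; rewrite !inE eqxx.
- by apply/subsetP => x; rewrite in_set2 => /orP[] /eqP ->; apply: LH.
move=> w f wH _ fF wf.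
have wv : w = v.
  by move: fF wf; rewrite E_sym in_set2 => /orP[] /eqP-> /Lv->.
subst w; move: fF; rewrite in_set2 => /orP[] /eqP->.
  by exists l'; rewrite !inE eqxx orbT vL // eq_sym ll'.
by exists l; rewrite !inE eqxx vL // ll'.
Qed.

(** A fort that avoids [L :\ l] avoids [v], hence restricts to a fort of
    [G]; the restriction is nonempty, as [[set l]] is not a fort. *)
Lemma forcing_star_add S l :
  forcing E G S -> l \in L -> forcing E H (S :|: L :\ l).
Proof.
move=> /forcingP fS lL; apply/forcingP => F fF.
have [F0 FH hF] := fortP _ _ _ fF.
case: (pickP [pred x in L :\ l | x \in F]) => [x /andP[xL xF]|none].
  by exists x; rewrite // inE xL orbT.
have FL x : x \in F -> x \in L -> x = l.
  move=> xF xL; apply/eqP; have := none x; rewrite /= !inE xF.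
  by move: xL; rewrite !inE => ->; case: eqP.
have vF : v \notin F.
  have [l' l'L l'l] := other_leaf l.
  apply/negP => vF; have := fort_center_leaf fF vH l'L vF.
  by move/FL/(_ l'L)/eqP; apply/negP.
have FG x : x \in F -> x != l -> x \in G.
  move=> xF xl; rewrite GE (subsetP FH _ xF) andbT.
  rewrite (contraNneq _ vF) => [|<-//] /=.
  by apply: contraNN xl => xL; rewrite (FL x).
have fFG : fort E G (F :&: G).
  apply/fortP; split; rewrite ?subsetIr //.
    apply/set0Pn; case: (boolP (l \in F)) => lF; last first.
      case/set0Pn: F0 => x xF; exists x; rewrite inE xF FG //.
      by apply: contraNneq lF => <-.
    have [g [gF _ gl]] := hF v l vH vF lF (vL lL).
    by exists g; rewrite inE gF FG.
  move=> w f wG; rewrite !in_setI wG andbT => wF /andP[fF' _] wf.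
  have [g [gF wg gf]] := hF w f (subsetP GH _ wG) wF fF' wf.
  exists g; rewrite in_setI gF FG //.
  by apply: contraTneq wg => ->; apply: GL.
have [x xS] := fS _ fFG; rewrite inE => /andP[xF _].
by exists x; rewrite // inE xS.
Qed.

(** A fort of [G] becomes a fort of [H] after adding [l] if [v] has just one
    neighbour in it: [l] is then a second one. *)
Lemma forcing_star_restrict S l :
  forcing E H S -> l \in L -> l \notin S -> forcing E G (S :&: G).
Proof.
move=> /forcingP fS lL lS; apply/forcingP => F fF.
have [F0 FG hF] := fortP _ _ _ fF.
suff [x xS xF] : exists2 x, x \in S & x \in F.
  by exists x; rewrite // inE xS (subsetP FG).
case: (boolP (#|nbrs E F v| == 1)) => [|nv]; last first.
  exact: (fS _ (fort_of_remaining fF nv)).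
case/cards1P => u Eu.
have : u \in nbrs E F v by rewrite Eu set11.
rewrite inE => /andP[uF vu].
suff fl : fort E H (l |: F).
  have [x xS] := fS _ fl; rewrite in_setU1 => /predU1P[xl|xF].
    by rewrite -xl xS in lS.
  by exists x.
apply/fortP; split.
- by apply/set0Pn; exists l; rewrite !inE eqxx.
- by rewrite subUset sub1set LH // (subset_trans FG GH).
move=> w f wH; rewrite !in_setU1 negb_or => /andP[wl wF] fF' wf.
case: (eqVneq w v) => [wv|wv].
  case: (eqVneq f l) => fl; first exists u.
    rewrite in_setU1 uF orbT wv; split=> //; rewrite fl.
    by apply: contraTneq (subsetP FG _ uF) => ->; rewrite GE lL andbF.
  by exists l; rewrite in_setU1 eqxx wv vL // eq_sym.
case/predU1P: fF' => [fl|fF'].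
  by rewrite fl E_sym in wf; case/eqP: wv; apply: Lv wf.
have wG : w \in G.
  rewrite GE wv wH andbT; apply/negP => wL.
  by have := GL (subsetP FG _ fF') wL; rewrite E_sym wf.
have [g [gF wg gf]] := hF w f wG wF fF' wf.
by exists g; rewrite in_setU1 gF orbT.
Qed.

Lemma minimal_forcing_star_add S l :
  minimal_forcing E G S -> l \in L -> minimal_forcing E H (S :|: L :\ l).
Proof.
case/minimal_forcingP=> SG fS mS lL; apply/minimal_forcingP; split.
- rewrite subUset (subset_trans SG GH); apply/subsetP => x.
  by rewrite in_setD1 => /andP[_ /LH].
- exact: forcing_star_add.
have SL x : x \in L -> x \notin S.
  by move=> xL; apply/negP => /(subsetP SG); rewrite GE xL andbF.
move=> x; rewrite in_setU in_setD1 => /orP[xS|/andP[xl xL]].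
  apply: contra (mS x xS) => fx.
  have lx : l \notin (S :|: L :\ l) :\ x.
    by rewrite !in_setD1 in_setU in_setD1 eqxx /= orbF (negPf (SL l lL)) andbF.
  apply: forcingS (forcing_star_restrict fx lL lx).
  apply/subsetP => y; rewrite in_setI !in_setD1 in_setU in_setD1 GE.
  by case/andP=> /andP[-> /orP[//|/andP[_ ->]]]; rewrite andbF.
apply: (not_forcing (fort_two_leaves xL lL xl)) => y.
rewrite in_setD1 in_setU in_setD1 !inE negb_or => /andP[-> /orP[yS|/andP[]]] //.
by apply: contraTneq yS => ->; apply: SL.
Qed.

Lemma minimal_forcing_no_center S l :
  minimal_forcing E H S -> l \in L -> l \in S -> v \notin S.
Proof.
case/minimal_forcingP=> _ /forcingP fS mS lL lS; apply/negP => vS.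
have /negP := mS v vS; apply; apply/forcingP => F fF.
have [x xS xF] := fS F fF; case: (eqVneq x v) => [xv|xv].
  exists l; last by apply: fort_center_leaf fF vH lL _; rewrite -xv.
  by rewrite in_setD1 lS andbT; apply: contraTneq lL => ->.
by exists x; rewrite // in_setD1 xv.
Qed.

(** When [S] contains all of [L], the forts of [G] missed by [S] share a
    vertex [u], the one that [v] forces: [v] has a single neighbour in each
    of them, and the same one in any two because their union is again a
    missed fort. *)
Lemma minimal_forcing_star_remove S :
  acyclic_graph E -> minimal_forcing E H S ->
  exists2 S', minimal_forcing E G S' & #|S| = #|S'| + #|L|.-1.
Proof.
move=> acE mfS; have [SH fS mS] := minimal_forcingP _ _ _ mfS.
have outG : v \notin S -> S :\: G = S :&: L.
  move=> vS; apply/setP=> x; rewrite in_setD in_setI GE.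
  case xS: (x \in S); rewrite ?andbF //= (subsetP SH _ xS) !andbT.
  have -> : x != v by apply: contraNneq vS => <-.
  by rewrite negbK.
case: (pickP [pred l in L | l \notin S]) => [l /andP[lL lS]|LS].
  have LlS x : x \in L -> x != l -> x \in S.
    move=> xL xl; have /forcingP/(_ _ (fort_two_leaves xL lL xl))[y yS] := fS.
    by rewrite in_set2 => /orP[/eqP<-//|/eqP yl]; rewrite /= -yl yS in lS.
  have [l' l'L l'l] := other_leaf l.
  have vS := minimal_forcing_no_center mfS l'L (LlS _ l'L l'l).
  exists (S :&: G).
    apply/minimal_forcingP; split; first exact: subsetIr.
      exact: forcing_star_restrict fS lL lS.
    move=> x; rewrite in_setI => /andP[xS xG]; apply: contra (mS x xS) => fx.
    apply: forcingS (forcing_star_add fx lL); apply/subsetP => y.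
    rewrite in_setU !in_setD1 in_setI => /orP[/and3P[-> ->]//|/andP[yl yL]].
    by rewrite LlS // andbT; apply: contraTneq xG => <-; rewrite GE yL andbF.
  rewrite -(cardsID G S) (outG vS) (cardsD1 l L) lL.
  congr (_ + #|pred_of_set _|).
  apply/setP=> x; rewrite in_setI in_setD1 andbC; case: (boolP (x \in L)) => xL.
    by case: eqP => [->|/eqP xl] /=; [exact: negPf | exact: LlS].
  by rewrite andbF.
have {}LS l : l \in L -> l \in S.
  by move=> lL; have := LS l; rewrite /= lL => /negbFE.
have [l lL _] := other_leaf v.
have vS := minimal_forcing_no_center mfS lL (LS l lL).
have missed F : fort E G F -> [disjoint S :&: G & F] ->
    exists2 u, u \in F & nbrs E F v = [set u].
  move=> fF dF; have [_ FG _] := fortP _ _ _ fF.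
  case: (boolP (#|nbrs E F v| == 1)) => [/cards1P[u Eu]|nv].
    exists u => //; have : u \in nbrs E F v by rewrite Eu set11.
    by rewrite inE => /andP[].
  have /forcingP/(_ _ (fort_of_remaining fF nv))[x xS xF] := fS.
  by have := disjointFl dF xF; rewrite inE xS (subsetP FG).
(* Otherwise one of the leaves in [S] could be dropped. *)
have nf : ~~ forcing E G (S :&: G).
  have /negP nfl := mS l (LS l lL); apply/negP => fG; apply: nfl.
  apply: forcingS (forcing_star_add fG lL); apply/subsetP => y.
  rewrite in_setU !in_setD1 in_setI => /orP[/andP[yS yG]|/andP[-> /LS]//].
  by rewrite yS andbT; apply: contraTneq yG => ->; rewrite GE lL andbF.
have /forallPn[F0] := nf; rewrite negb_imply negbK => /andP[fF0 dF0].
have [u uF0 Eu] := missed _ fF0 dF0.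
have uG : u \in G by have [_ /subsetP/(_ _ uF0)] := fortP _ _ _ fF0.
have vu : E v u.
  have : u \in nbrs E F0 v by rewrite Eu set11.
  by rewrite inE => /andP[].
have uS : u \notin S by have := disjointFl dF0 uF0; rewrite inE uG andbT => ->.
have fu : forcing E G (u |: S :&: G).
  apply/forcingP => F fF; case: (boolP [disjoint S :&: G & F]); last first.
    by case/pred0Pn => x /andP[/= xS xF]; exists x; rewrite // in_setU1 xS orbT.
  move=> dF; have dU : [disjoint S :&: G & F :|: F0].
    by rewrite disjoints_subset setCU subsetI -!disjoints_subset dF.
  have [w wF Ew] := missed _ (fortU fF fF0) dU.
  have [w' w'F Ew'] := missed _ fF dF.
  have : u \in nbrs E (F :|: F0) v by rewrite !inE uF0 orbT.
  have : w' \in nbrs E F v by rewrite Ew' set11.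
  rewrite inE => /andP[_ vw'].
  have : w' \in nbrs E (F :|: F0) v by rewrite !inE w'F.
  rewrite Ew !in_set1 => /eqP ew' /eqP eu.
  by exists u; rewrite ?in_setU1 ?eqxx // eu -ew'.
exists (u |: S :&: G); last first.
  rewrite -(cardsID G S) (outG vS) cardsU1 in_setI (negPf uS) /=.
  have -> : S :&: L = L.
    by apply/setIidPr/subsetP.
  by rewrite (cardsD1 l L) lL /= addnCA !addnA.
apply/minimal_forcingP; split=> //.
  by rewrite subUset sub1set uG subsetIr.
move=> x; rewrite in_setU1 => /predU1P[->|].
  by rewrite setU1K // in_setI (negPf uS).
rewrite in_setI => /andP[xS xG]; apply: contra (mS x xS) => /forcingP fx.
apply/forcingP => F fF; have [F0' FH hF] := fortP _ _ _ fF.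
case: (pickP [pred y in S :\ x | y \in F]) => [y /andP[yS yF]|SF].
  by exists y.
have LF y : y \in L -> y \notin F.
  move=> yL; have := SF y; rewrite /= in_setD1 (LS y) // andbT => /negbT.
  rewrite negb_and negbK => /orP[/eqP yx|//].
  by rewrite -yx GE yL andbF in xG.
have vF : v \notin F.
  by apply/negP => /(fort_center_leaf fF vH lL); apply/negP/LF.
have FG : F \subset G.
  apply/subsetP => y yF; rewrite GE (subsetP FH _ yF) andbT.
  rewrite (contraTneq _ yF) => [|->//] /=.
  by apply: contraTN yF; apply: LF.
have fFG := fort_avoiding_star fF FG.
(* Here [F] is a fort of [H] missed by [S :\ x].  Since [v] does not have a
   unique neighbour in it, [F] also contains a neighbour of [v] separated from
   [u] in [G]; cutting away the component [K] of [u] leaves a fort of [G]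
   that [u |: S :&: G :\ x] fails to meet. *)
have onlyu F' : F' \subset F -> fort E G F' -> u \in F'.
  move=> F'F fF'; have [y] := fx _ fF'.
  rewrite in_setD1 in_setU1 in_setI.
  case/andP=> yx /predU1P[-> //|/andP[yS yG]] yF'.
  by have := SF y; rewrite /= in_setD1 yx yS (subsetP F'F).
have uF := onlyu F (subxx _) fFG.
have [u' [u'F vu' u'u]] := hF v u vH vF uF vu.
have vG : v \notin G by rewrite GE eqxx.
have ncu := nbrs_disconnected acE vG uG vu vu' _.
pose K := [set y | connect (induced G) u y].
have fK : fort E G (F :\: K).
  apply/fortP; split.
  - by apply/set0Pn; exists u'; rewrite in_setD u'F inE ncu // eq_sym.
  - by rewrite (subset_trans (subsetDl _ _)).
  move=> w f wG; rewrite !in_setD negb_and negbK => wKF /andP[fK fF'] wf.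
  have KN y : y \in F -> E w y -> (y \in K) = (w \in K).
    move=> yF wy; have yG := subsetP FG _ yF.
    have yw : E y w by rewrite E_sym.
    rewrite !inE; apply/idP/idP => /connect_trans; apply; apply/connect1.
      by rewrite /induced yw yG wG.
    by rewrite /induced wy wG yG.
  move: wKF; rewrite -(KN f) // (negPf fK) /= => wF.
  have [g [gF wg gf]] := hF w f (subsetP GH _ wG) wF fF' wf.
  by exists g; rewrite in_setD gF KN // -(KN f) // fK.
have := onlyu _ (subsetDl _ _) fK.
by rewrite in_setD inE connect0.
Qed.

Lemma equiforced_star :
  acyclic_graph E -> equiforced E H <-> equiforced E G.
Proof.
move=> acE; have [l lL _] := other_leaf v; split=> eqf S S' mS mS'.
  have cardA T : minimal_forcing E G T ->
      #|T :|: L :\ l| = #|T| + #|L :\ l|.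
    case/minimal_forcingP=> TG _ _; rewrite cardsU.
    suff -> : T :&: (L :\ l) = set0 by rewrite cards0 subn0.
    apply/setP=> x; rewrite in_setI in_setD1 in_set0.
    apply/negP => /and3P[/(subsetP TG)]; rewrite GE => /and3P[_ xL _] _.
    exact/negP.
  have mSl := minimal_forcing_star_add mS lL.
  have := eqf _ _ mSl (minimal_forcing_star_add mS' lL).
  by rewrite !cardA // => /addIn.
have [T mT ->] := minimal_forcing_star_remove acE mS.
have [T' mT' ->] := minimal_forcing_star_remove acE mS'.
by rewrite (eqf T T').
Qed.

(** A vertex whose only neighbour was [v] is a leaf at [v], so it is removed
    together with [v]. *)
Lemma no_isolated_star :
  {in H, forall x, nbrs E H x != set0} -> {in G, forall x, nbrs E G x != set0}.
Proof.
move=> niH x xG; have xH := subsetP GH _ xG; apply/negP => /eqP nx.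
have := niH x xH; apply/negP; rewrite negbK.
have nv y : y \in nbrs E H x -> y = v.
  rewrite inE => /andP[yH xy]; apply/eqP; case: (boolP (y \in L)) => [yL|yL].
    by rewrite (negPf (GL xG yL)) in xy.
  apply/negPn/negP => yv; have : y \in nbrs E G x by rewrite inE GE yv yL yH xy.
  by rewrite nx inE.
apply: contraT => /set0Pn[y ny].
move: (xG); rewrite GE => /and3P[_ xL _]; case/negP: xL.
have ey := nv y ny; move: ny; rewrite inE ey => /andP[_ xv].
rewrite !inE xH E_sym xv /=; apply/cards1P; exists v; apply/setP=> z.
rewrite in_set1; apply/idP/eqP => [/nv//|->].
by rewrite inE vH.
Qed.

End OneStar.

End StarRemoval.

(** * Forests without removable stars *)

Section RootedForests.

Variables (V : finType) (E : rel V).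
Hypotheses (E_sym : symmetric E) (E_irr : irreflexive E).
Implicit Types (H F S W : {set V}) (depth : V -> nat).

(** A root in every component, encoded by depths: the parent of [y] is its
    unique neighbour of smaller [depth]. Only the comparison of adjacent
    vertices matters, so [depth] need not be the distance to the root. *)
Definition rooting H depth : Prop :=
  {in H &, forall x y, E x y -> depth x != depth y} /\
  {in H & &, forall x x' y, E x y -> E x' y ->
     depth x < depth y -> depth x' < depth y -> x = x'}.

Definition children H depth x : {set V} :=
  [set y in nbrs E H x | depth x < depth y].

Definition internal H depth : {set V} :=
  [set x in H | children H depth x != set0].

(** The walk with vertices [z :: q], listed backwards, is extended at [z] as
    long as possible: at the end, a further neighbour of [z] on the walk
    would close a cycle. The number [n] bounds how many more steps are
    possible. *)
Lemma end_vertex_from W z q n :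
  acyclic_graph E -> #|V| <= n + size q ->
  path (induced E W) z q -> z \in W -> uniq (z :: q) ->
  exists y, [/\ y \in W, #|nbrs E W y| <= 1 &
                y = last z q -> nbrs E W y = set0].
Proof.
move=> acE; elim: n z q => [|n IHn] z q leVn pth zW uq.
  have := max_card [in z :: q]; rewrite (card_uniqP uq) /= => leq.
  by have := leq_trans leq leVn; rewrite ltnn.
case: q leVn pth uq => [|h q] leVn pth uq.
  have [nz|[w]] := set_0Vmem (nbrs E W z).
    by exists z; split; rewrite ?nz ?cards0.
  rewrite inE => /andP[wW zw].
  have wz : w != z by apply: contraTneq zw => ->; rewrite E_irr.
  have wz1 : path (induced E W) w [:: z] by rewrite /= /induced E_sym zw wW zW.
  apply: (IHn w [:: z]) => //=; first by move: leVn; rewrite /= addn0 addn1.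
  by rewrite inE wz.
case: (leqP #|nbrs E W z| 1) => [le1|gt1].
  exists z; split=> // elast; move: uq; rewrite cons_uniq {1}elast /=.
  by rewrite mem_last.
have : 0 < #|nbrs E W z :\ h|.
  by have := gt1; rewrite (cardsD1 h); case: (h \in _) => // /ltnW.
rewrite card_gt0 => /set0Pn[w]; rewrite in_setD1 inE => /and3P[wh wW zw].
have wz : w != z by apply: contraTneq zw => ->; rewrite E_irr.
case: (boolP (w \in h :: q)) => wq.
  rewrite inE (negPf wh) /= in wq.
  case/splitPr: wq uq pth {leVn} => p1 p2 uq pth.
  case: (acE [:: z, h & rcons p1 w]); first by rewrite /= size_rcons.
  apply/andP; split.
    rewrite /= rcons_path last_rcons (E_sym w) zw andbT.
    move: pth; rewrite -cat_rcons /= cat_path => /and3P[/andP[-> _] pth _] /=.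
    by apply: sub_path pth => x y /andP[].
  by move: uq; rewrite -cat_rcons -!cat_cons cat_uniq => /andP[].
have pth' : path (induced E W) w [:: z, h & q].
  by move: pth; rewrite /= => ->; rewrite /induced E_sym zw wW zW.
apply: (IHn w [:: z, h & q]) => //; first by rewrite /= -addSnnS.
by rewrite cons_uniq uq inE (negPf wz) wq.
Qed.

(** The end vertex found is [x0] only if [x0] is isolated; so, when end
    vertices are removed one by one, a prescribed root can be made to
    outlast its neighbours. *)
Lemma acyclic_end_vertex W x0 :
  acyclic_graph E -> x0 \in W ->
  exists y, [/\ y \in W, #|nbrs E W y| <= 1 & y = x0 -> nbrs E W y = set0].
Proof.
by move=> acE x0W; apply: (@end_vertex_from W x0 [::] #|V|); rewrite ?addn0.
Qed.

(** Remove end vertices one after another and number the vertices in the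
    reverse order: the parent of [y] is the one neighbour still present when
    [y] is removed. *)
Lemma acyclic_rooting W l :
  acyclic_graph E ->
  exists depth, rooting W depth /\
    (l \in W -> {in nbrs E W l, forall y, depth l < depth y}).
Proof.
move=> acE; have [n] := ubnP #|W|; elim: n W => // n IHn W leWn.
have [W0|[x0 x0W]] := set_0Vmem W.
  exists (fun=> 0); split; last by rewrite W0 inE.
  by split=> x; rewrite W0 inE.
have x1W : (if l \in W then l else x0) \in W by case: ifP.
have [y [yW ny yl]] := acyclic_end_vertex acE x1W.
have [|depth [[nd up] dl]] := IHn (W :\ y).
  by move: leWn; rewrite (cardsD1 y W) yW.
pose d x := if x == y then (\max_z depth z).+1 else depth x.
have dlt x : x != y -> d x < d y.
  by move=> xy; rewrite /d (negPf xy) eqxx ltnS leq_bigmax.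
have dE x : x != y -> d x = depth x by rewrite /d => /negPf->.
exists d; split; first split.
- move=> x z xW zW xz; case: (eqVneq x y) => [xy|xy].
    rewrite neq_ltn orbC xy dlt //.
    by apply: contraTneq xz => ->; rewrite xy E_irr.
  case: (eqVneq z y) => [zy|zy]; first by rewrite neq_ltn zy dlt.
  by rewrite !dE // nd // in_setD1 ?xy ?zy.
- move=> x x' z xW x'W zW xz x'z; case: (eqVneq z y) => [zy _ _|zy].
    move/card_le1_eqP: ny; apply; rewrite inE ?xW ?x'W E_sym -zy //.
  case: (eqVneq x y) => [->|xy]; first by rewrite ltnNge ltnW ?dlt.
  case: (eqVneq x' y) => [->|x'y]; first by move=> _; rewrite ltnNge ltnW ?dlt.
  by rewrite !dE //; apply: up; rewrite // in_setD1 ?xy ?zy ?x'y.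
move=> lW z nz; rewrite lW in yl.
case: (eqVneq l y) => [ly|ly].
  by move: nz; rewrite ly yl // inE.
case: (eqVneq z y) => [->|zy]; first exact: dlt.
rewrite !dE //; apply: dl; first by rewrite in_setD1 ly.
by move: nz; rewrite !inE zy.
Qed.

Section Tops.

Variables (H : {set V}) (depth : V -> nat).
Hypotheses (rootH : rooting H depth).
Hypothesis few_leaves : {in H, forall v, #|leaf_nbrs E H v| <= 1}.

Let ch := children H depth.

Lemma childP x y : reflect [/\ y \in H, E x y & depth x < depth y] (y \in ch x).
Proof. by rewrite !inE -andbA; apply: and3P. Qed.

Lemma parent_uniq x x' y :
  x \in H -> x' \in H -> y \in ch x -> y \in ch x' -> x = x'.
Proof.
move=> xH x'H /childP[yH xy dxy] /childP[_ x'y dx'y].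
exact: rootH.2 xy x'y dxy dx'y.
Qed.

Definition favourite x : V :=
  if [pick y in ch x | ch y == set0] is Some y then y
  else odflt x [pick y in ch x].

Lemma favourite_child x : ch x != set0 -> favourite x \in ch x.
Proof.
rewrite /favourite; case: pickP => [y /andP[]//|_].
by case: pickP => //= ch0 /set0Pn[y]; rewrite ch0.
Qed.

Lemma favourite_mem x y : y \in ch x -> favourite x \in ch x.
Proof. by move=> yx; apply: favourite_child; apply/set0Pn; exists y. Qed.

(** A childless child is a leaf, and there is at most one leaf at [x]; the
    favourite was chosen to be that leaf. *)
Lemma unfavoured_child x y :
  x \in H -> y \in ch x -> y != favourite x -> ch y != set0.
Proof.
move=> xH yx; apply: contraNneq => y0; rewrite /favourite.
case: pickP; last first.
  by move/(_ y); rewrite /= yx y0 eqxx.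
have leaf z : z \in ch x -> ch z = set0 -> z \in leaf_nbrs E H x.
  move=> zx z0; have [zH xz dxz] := childP _ _ zx.
  rewrite !inE zH xz; apply/cards1P; exists x; apply/setP=> w.
  rewrite !inE; apply/andP/eqP => [[wH zw]|->]; last by rewrite xH E_sym.
  have wz : E w z by rewrite E_sym.
  have := rootH.1 _ _ wH zH wz; rewrite neq_ltn => /orP[dwz|dzw].
    exact: rootH.2 wz xz dwz dxz.
  by have : w \in ch z by [apply/childP]; rewrite z0 inE.
move=> z /andP[zx /eqP z0]; apply/eqP.
by apply: (card_le1_eqP (few_leaves xH)); apply: leaf.
Qed.

Definition tops : {set V} := H :\: [set favourite x | x in internal H depth].

Lemma internalP x : reflect (x \in H /\ ch x != set0) (x \in internal H depth).
Proof. by rewrite inE; apply: andP. Qed.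

Lemma not_topP y :
  y \in H -> reflect (exists x, [/\ x \in H, y \in ch x & y = favourite x])
                     (y \notin tops).
Proof.
move=> yH; rewrite in_setD yH andbT negbK.
apply: (iffP imsetP) => [[x /internalP[xH nx] ->]|[x [xH yx ->]]];
  exists x => //.
  by split=> //; apply: favourite_child.
by apply/internalP; split=> //; apply/set0Pn; exists y.
Qed.

Lemma card_tops : #|tops| + #|internal H depth| = #|H|.
Proof.
have inj : {in internal H depth &, injective favourite}.
  move=> x x' /internalP[xH nx] /internalP[x'H nx'] exx'.
  apply: parent_uniq xH x'H (favourite_child nx) _.
  by rewrite exx'; apply: favourite_child.
rewrite -(card_in_imset inj) cardsD addnC.
suff sub : [set favourite x | x in internal H depth] \subset H.
  by rewrite (setIidPr sub) subnKC // subset_leq_card.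
apply/subsetP => _ /imsetP[x /internalP[_ /favourite_child/childP[fH _ _]] ->].
exact: fH.
Qed.

(** In a missed fort, a vertex of least depth is the favourite of its
    parent, and it is the only neighbour of this parent in the fort: the
    others are either of smaller depth or tops. *)
Lemma tops_forcing : forcing E H tops.
Proof.
apply/forcingP => F fF; have [F0 FH hF] := fortP _ _ _ fF.
case/set0Pn: F0 => f0 f0F.
case: (@arg_minnP _ f0 [in F] depth f0F) => f fF' minf.
case: (boolP (f \in tops)) => [fX|fX]; first by exists f.
have [c [cH fc ef]] := not_topP (subsetP FH _ fF') fX.
have [fH cf dcf] := childP _ _ fc.
have cF : c \notin F.
  by apply/negP => cF; have := minf c cF; rewrite leqNgt dcf.
have [g [gF cg gf]] := hF c f cH cF fF' cf.
exists g => //; apply: contraNT gf => gX.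
have gH := subsetP FH _ gF; have [c' [c'H gc' eg]] := not_topP gH gX.
suff gc : g \in ch c by rewrite ef eg (parent_uniq c'H cH gc' gc).
by apply/childP; split=> //; apply: leq_trans dcf (minf g gF).
Qed.

(** Closing under [step] keeps the children of [f] from having [f] as their
    unique neighbour in a fort: the favourite joins the fort, while an
    unfavoured child [z] is a top, so it stays outside and gets its own
    favourite as a second neighbour. *)
Let step : rel V := fun f g =>
  ((g == favourite f) && (g \in ch f)) ||
  [exists z in ch f, [&& z != favourite f, g \in ch z & g == favourite z]].

(** Without the top [x], the set misses the fort generated from [x] and, if
    [x] has a parent [y], from the favourite of [y], so that [y] has two
    neighbours in it. *)
Lemma tops_minimal x : x \in tops -> ~~ forcing E H (tops :\ x).
Proof.
move=> xX; have xH : x \in H by move: xX; rewrite in_setD => /andP[].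
pose F0 := x |: [set favourite y | y in [set y in H | x \in ch y]].
pose F := [set w | [exists s in F0, connect step s w]].
have F0F s : s \in F0 -> s \in F.
  by move=> sF0; rewrite inE; apply/existsP; exists s; rewrite sF0 connect0.
have xF : x \in F by apply: F0F; rewrite in_setU1 eqxx.
have stepF f g : f \in F -> step f g -> g \in F.
  rewrite !inE => /exists_inP[s sF0 sf] fg; apply/exists_inP; exists s => //.
  exact: connect_trans sf (connect1 fg).
have F0P s : s \in F0 -> s = x \/
    exists y, [/\ y \in H, x \in ch y, s \in ch y & s = favourite y].
  rewrite in_setU1 => /predU1P[->|]; first by left.
  case/imsetP => y; rewrite inE => /andP[yH xy] ->; right; exists y; split=> //.
  exact: favourite_mem xy.
have FP f : f \in F -> f \in F0 \/ exists2 g, g \in F & step g f.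
  rewrite inE => /exists_inP[s sF0 /connectP[p]].
  case/lastP: p => [_ ->|p w]; first by left.
  rewrite rcons_path last_rcons => /andP[sp stp] ->; right.
  exists (last s p) => //; rewrite inE; apply/exists_inP; exists s => //.
  by apply/connectP; exists p.
have FH f : f \in F -> f \in H.
  case/FP => [/F0P[->//|[y [_ _ /childP[]//]]]|[g gF]].
  by case/orP=> [/andP[_ /childP[]]//|/exists_inP[z _ /and3P[_ /childP[]]]].
have fF : fort E H F.
  apply/fortP; split; first by apply/set0Pn; exists x.
    by apply/subsetP.
  move=> w f wH wF fF wf; have fH := FH f fF.
  have := rootH.1 _ _ wH fH wf; rewrite neq_ltn => /orP[dwf|dfw].
    have fw : f \in ch w by apply/childP.
    case/FP: (fF) => [/F0P[fx|[y [yH xy fy ef]]]|[g gF]].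
    - rewrite fx in fw; exists (favourite w).
      have qw := favourite_mem fw; have [_ wq _] := childP _ _ qw.
      split=> //.
        apply: F0F; rewrite in_setU1; apply/orP; right; apply/imsetP.
        by exists w; rewrite // inE wH.
      rewrite fx; apply: contraTneq xX => eq; apply/not_topP => //.
      by exists w.
    - have ewy := parent_uniq wH yH fw fy; subst y.
      exists x; have [_ wx _] := childP _ _ xy; split=> //.
      apply: contraTneq xX => exf; apply/not_topP => //.
      by exists w; rewrite {2}exf.
    case/orP=> [/andP[_ fg]|/exists_inP[z zg /and3P[_ fz _]]].
      by rewrite (parent_uniq wH (FH g gF) fw fg) gF in wF.
    have [zH gz dgz] := childP _ _ zg; have ewz := parent_uniq wH zH fw fz.
    exists g; rewrite gF ewz E_sym gz; split=> //.
    by apply: contraTneq dgz => ->; rewrite -ewz ltnNge ltnW.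
  have wcf : w \in ch f by apply/childP; rewrite E_sym.
  have wq : w != favourite f.
    apply: contraNneq wF => ew; apply: stepF fF _.
    by rewrite /step ew eqxx -ew wcf.
  have qw := favourite_child (unfavoured_child fH wcf wq).
  have [_ wqw dq] := childP _ _ qw.
  exists (favourite w); split=> //.
    apply: stepF fF _; apply/orP; right; apply/exists_inP; exists w => //.
    by rewrite wq qw eqxx.
  by apply: contraTneq dq => ->; rewrite -leqNgt ltnW.
apply: (not_forcing fF) => y; rewrite in_setD1 => /andP[yx yX].
apply: contraTN yX => yF; apply/not_topP; first exact: FH.
case/FP: yF => [/F0P[eyx|[z [zH _ yz ey]]]|[g gF]].
- by rewrite eyx eqxx in yx.
- by exists z.
case/orP=> [/andP[/eqP ey yg]|/exists_inP[z]].
  by exists g; rewrite FH.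
case/childP=> zH _ _ /and3P[_ yz /eqP ey].
by exists z.
Qed.

Lemma minimal_forcing_tops : minimal_forcing E H tops.
Proof.
apply/minimal_forcingP; split; first exact: subsetDl.
  exact: tops_forcing.
exact: tops_minimal.
Qed.

End Tops.

(** Moving the root from the leaf [l] to its neighbour [a] reverses only the
    edge between them: [l] becomes childless, [a] still has another child,
    and all other vertices keep their children. *)
Lemma not_equiforced H a l :
  acyclic_graph E -> {in H, forall v, #|leaf_nbrs E H v| <= 1} ->
  l \in H -> a \in H -> nbrs E H l = [set a] -> 1 < #|nbrs E H a| ->
  ~ equiforced E H.
Proof.
move=> acE few lH aH nl na eqf.
have la : E l a.
  have : a \in nbrs E H l by rewrite nl set11.
  by rewrite inE => /andP[].
have al : E a l by rewrite E_sym.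
have nal : a != l by apply: contraTneq la => ->; rewrite E_irr.
have [d [rd dl]] := acyclic_rooting H l acE; have [nd up] := rd.
have dla : d l < d a by apply: dl; rewrite ?nl ?set11.
have above x : x \in H -> E a x -> x != l -> d a < d x.
  move=> xH ax xl; have := nd _ _ aH xH ax; rewrite neq_ltn => /orP[//|dxa].
  case/eqP: xl; apply: (up _ _ a) => //; by rewrite E_sym.
(* Shifting all depths by one frees the value 0 for the new root [a]. *)
pose d' x := if x == a then 0 else (d x).+1.
have d'E x : x != a -> d' x = (d x).+1 by rewrite /d' => /negPf->.
have d'a : d' a = 0 by rewrite /d' eqxx.
have rd' : rooting H d'.
  split=> [x y xH yH xy|x x' y xH x'H yH xy x'y].
    case: (eqVneq x a) => [xa|xa]; last first.
      case: (eqVneq y a) => [->|ya]; first by rewrite d'a d'E.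
      by rewrite !d'E // eqSS nd.
    rewrite xa d'a d'E //.
    by apply: contraTneq xy => ->; rewrite xa E_irr.
  case: (eqVneq y a) => [->|ya]; first by rewrite d'a.
  case: (eqVneq y l) => [yl _ _|yl].
    have: x \in nbrs E H l by rewrite inE xH E_sym -yl.
    have: x' \in nbrs E H l by rewrite inE x'H E_sym -yl.
    by rewrite nl !inE => /eqP-> /eqP->.
  have low z : z \in H -> E z y -> d' z < d' y -> d z < d y.
    move=> zH zy; case: (eqVneq z a) => [za _|za]; last by rewrite !d'E.
    by rewrite za; apply: above; rewrite // -za.
  by move=> /(low _ xH xy) lx /(low _ x'H x'y) lx'; apply: (up x x' y).
have eI : internal H d = l |: internal H d'.
  apply/setP=> x; rewrite in_setU1 !inE; case: (eqVneq x l) => [->|xl] /=.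
    by rewrite lH; apply/set0Pn; exists a; rewrite !inE aH la.
  case xH: (x \in H) => //=; case: (eqVneq x a) => [->|xa].
    have : 0 < #|nbrs E H a :\ l|.
      by have := na; rewrite (cardsD1 l); case: (l \in _) => // /ltnW.
    rewrite card_gt0 => /set0Pn[w]; rewrite in_setD1 inE => /and3P[wl wH aw].
    have wa : w != a by apply: contraTneq aw => ->; rewrite E_irr.
    by apply/set0Pn/set0Pn => _; exists w; rewrite !inE wH aw ?above // d'a d'E.
  congr (_ != set0); apply/setP=> y; rewrite !inE.
  case yH: (y \in H) => //=; case xy: (E x y) => //=.
  case: (eqVneq y a) => [ya|ya]; last by rewrite !d'E.
  rewrite ya d'a ltn0 ltnNge ltnW // above //.
  by rewrite E_sym -ya.
have lI : l \notin internal H d'.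
  rewrite inE lH /= negbK; apply/eqP/setP=> y; rewrite inE nl !inE.
  by case: eqP => // ->; rewrite d'a.
have := eqf _ _ (minimal_forcing_tops rd few) (minimal_forcing_tops rd' few).
have := card_tops rd; rewrite -(card_tops rd') eI cardsU1 lI => + e.
by rewrite e => /addnI/eqP; rewrite add1n; elim: #|_|.
Qed.

(** If no leaf were adjacent to a vertex of degree at least 2, the vertices
    of degree at least 2 would induce a subgraph without end vertex, which
    must then be empty. *)
Lemma equiforced_matching H :
  acyclic_graph E -> {in H, forall v, #|leaf_nbrs E H v| <= 1} ->
  {in H, forall x, nbrs E H x != set0} -> equiforced E H ->
  {in H, forall x, #|nbrs E H x| = 1}.
Proof.
move=> acE few ni eqf x xH; pose D := [set x in H | 1 < #|nbrs E H x|].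
have [D0|[x0 x0D]] := set_0Vmem D.
  have : x \notin D by rewrite D0 inE.
  rewrite inE xH -leqNgt => le1; apply/eqP.
  by rewrite eqn_leq le1 card_gt0 ni.
have [a [aD na _]] := acyclic_end_vertex acE x0D.
move: aD; rewrite inE => /andP[aH na2].
have : ~~ (nbrs E H a \subset nbrs E D a).
  by apply/negP => /subset_leq_card; rewrite leqNgt (leq_ltn_trans na).
case/subsetPn => l; rewrite !inE => /andP[lH al].
rewrite lH al andbT /= -leqNgt => nl.
case: (not_equiforced acE few lH aH _ na2 eqf).
have anl : a \in nbrs E H l by rewrite inE aH E_sym.
apply/setP=> y; rewrite in_set1; apply/idP/eqP => [ynl|->//].
exact: (card_le1_eqP nl).
Qed.

End RootedForests.

(** * Disjoint unions of [K_2] *)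

Section CopiesOfK2.

Variables (V : finType) (E : rel V).
Hypotheses (E_sym : symmetric E) (E_irr : irreflexive E).
Implicit Types (H F S : {set V}).

Lemma copies_of_matching H :
  {in H, forall x, #|nbrs E H x| = 1} -> copies_of_K2 E H.
Proof.
move=> m1; pose p x := odflt x [pick y in nbrs E H x].
have nE x : x \in H -> nbrs E H x = [set p x].
  move=> /m1 /eqP /cards1P[y Ey]; rewrite /p Ey.
  by case: pickP => [z|/(_ y)]; rewrite /= !inE ?eqxx // => /eqP->.
have pH x : x \in H -> p x \in H.
  move=> xH; have : p x \in nbrs E H x by rewrite nE // in_set1.
  by rewrite inE => /andP[].
have pE x y : x \in H -> y \in H -> E x y = (y == p x).
  move=> xH yH; have -> : E x y = (y \in nbrs E H x) by rewrite inE yH.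
  by rewrite nE // in_set1.
have pK x : x \in H -> p (p x) = x.
  move=> xH; apply/esym/eqP; rewrite -pE ?pH // E_sym pE ?pH //.
have pn x : x \in H -> p x != x.
  by move=> xH; rewrite eq_sym -pE // E_irr.
(* One end of each edge: the one that comes first in the enumeration. *)
pose A := [set x in H | enum_rank x < enum_rank (p x)].
have AH x : x \in A -> x \in H by rewrite inE => /andP[].
have AN x : x \in A -> p x \notin A.
  rewrite !inE => /andP[xH lx]; rewrite pK // pH //= -leqNgt.
  exact: ltnW.
have ev (i : 'I_#|A|) : enum_val i \in A := enum_valP i.
pose f (ib : 'I_#|A| * bool) :=
  if ib.2 then p (enum_val ib.1) else enum_val ib.1.
have fH ib : f ib \in H.
  by rewrite /f; case: ib.2; rewrite ?pH // AH.
have pf i b : p (f (i, b)) = f (i, ~~ b).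
  by rewrite /f; case: b => //=; rewrite pK // AH.
have finj : injective f.
  move=> [i b] [j c]; wlog bc : i j b c / b <= c => [wl e|].
    by case: (leqP b c) => [|/ltnW] bc; [|symmetry]; apply: wl.
  case: b c bc => [] [] // _; rewrite /f /= => e.
  - rewrite (enum_val_inj (_ : enum_val i = enum_val j)) //.
    by rewrite -[LHS]pK ?e ?pK ?AH.
  - by have := AN _ (ev j); rewrite -e ev.
  - by rewrite (enum_val_inj e).
exists #|A|, f; split=> //.
  apply/setP=> x; apply/idP/imsetP => [xH|[ib _ ->]//].
  case: (ltngtP (enum_rank x) (enum_rank (p x))) => lx.
  - have xA : x \in A by rewrite inE xH.
    by exists (enum_rank_in xA x, false); rewrite // /f /= enum_rankK_in.
  - have xA : p x \in A by rewrite inE pH // pK.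
    by exists (enum_rank_in xA (p x), true); rewrite // /f /= enum_rankK_in ?pK.
  - by have := pn x xH; rewrite -(enum_rank_inj (val_inj lx)) eqxx.
move=> [i b] [j c]; rewrite pE // pf (inj_eq finj) xpair_eqE eq_sym.
by case: b c => [] [].
Qed.

(** Every fort is a union of copies, and each single copy is a fort. *)
Lemma equiforced_copies H : copies_of_K2 E H -> equiforced E H.
Proof.
case=> k [f [finj eH fE]].
have fH p : f p \in H by rewrite eH imset_f.
have HP x : x \in H -> exists p, x = f p.
  by rewrite eH => /imsetP[p _ ->]; exists p.
have mate F p : fort E H F -> f p \in F -> f (p.1, ~~ p.2) \in F.
  case/fortP=> _ /subsetP FH hF fpF.
  case: (boolP (f (p.1, ~~ p.2) \in F)) => // nF.
  have [|g [gF]] := hF _ _ (fH _) nF fpF; first by rewrite fE eqxx; case: p.2.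
  have [q ->] := HP g (FH g gF); rewrite fE /= (inj_eq finj).
  by case: p q {fpF nF} => i [] [j []] //= /andP[/eqP->]; rewrite ?eqxx.
have pair i : fort E H [set f (i, true); f (i, false)].
  apply/fortP; split.
  - by apply/set0Pn; exists (f (i, true)); rewrite !inE eqxx.
  - by apply/subsetP => x; rewrite in_set2 => /orP[] /eqP->.
  move=> w g wH; have [[j b] ->] := HP w wH.
  rewrite !in_set2 !(inj_eq finj) negb_or => nw /orP[] /eqP ->;
    rewrite fE /= => /andP[/eqP ej]; move: nw;
    by rewrite ej !xpair_eqE eqxx; case: b.
suff cardS S : minimal_forcing E H S -> #|S| = k.
  by move=> S S' /cardS-> /cardS->.
case/minimal_forcingP=> SH fS mS.
have one i b : f (i, b) \in S -> f (i, ~~ b) \notin S.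
  move=> bS; apply/negP => nbS; have /negP := mS _ bS; apply.
  apply/forcingP => F fF; have /forcingP/(_ F fF)[x xS xF] := fS.
  case: (eqVneq x (f (i, b))) => [xb|xb]; last first.
    by exists x; rewrite // in_setD1 xb.
  exists (f (i, ~~ b)); last by apply: (mate F (i, b)) => //; rewrite -xb.
  rewrite in_setD1 nbS andbT (inj_eq finj) xpair_eqE eqxx.
  by case: b {bS nbS xb}.
pose g i := f (i, f (i, true) \in S).
have ginj : injective g by move=> i j /finj[].
have gS i : g i \in S.
  rewrite /g; case: (boolP (f (i, true) \in S)) => // nS.
  have /forcingP/(_ _ (pair i))[x xS] := fS.
  by rewrite in_set2 => /orP[/eqP ex|/eqP<-//]; rewrite -ex xS in nS.
rewrite -[RHS]card_ord -(card_imset _ ginj); apply: eq_card => x.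
apply/idP/imsetP => [xS|[i _ ->]//].
have [[i b] ex] := HP x (subsetP SH _ xS); rewrite ex in xS *.
exists i => //; rewrite /g; case: b {ex} xS => xS; first by rewrite xS.
by have /negPf-> := one _ _ xS.
Qed.

End CopiesOfK2.

Theorem theorem3p9 (V : finType) (E : rel V)
    (E_sym : symmetric E) (E_irr : irreflexive E) (E_tree : is_tree E)
    (V_nontrivial : 1 < #|V|)
    (R : {set V}) (R_result : star_removal_result E R) :
  well_forced E <-> copies_of_K2 E R.
Proof.
have [_ conE acE] := E_tree; have [toR stuck] := R_result.
have niT : {in [set: V], forall x, nbrs E [set: V] x != set0}.
  move=> x _; have : 0 < #|[set: V] :\ x|.
    by have := V_nontrivial; rewrite -cardsT (cardsD1 x) in_setT.
  rewrite card_gt0 => /set0Pn[y]; rewrite in_setD1 => /andP[yx _].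
  case/connectP: (conE x y) => -[|z p] /=.
    by move=> _ yx'; rewrite yx' eqxx in yx.
  by case/andP=> xz _ _; apply/set0Pn; exists z; rewrite !inE.
have [eqTR niR] : (equiforced E [set: V] <-> equiforced E R) /\
    {in R, forall x, nbrs E R x != set0}.
  case/connectP: toR niT {stuck R_result} => p; move: [set: V].
  elim: p => [|H' p IHp] H /=; first by move=> _ ->.
  case/andP=> /existsP[v /and3P[vH L2 /eqP eH']] pth eR niH.
  have niH' : {in H', forall x, nbrs E H' x != set0}.
    by rewrite eH'; apply: no_isolated_star.
  have [eqf niR] := IHp H' pth eR niH'; split=> //.
  apply: iff_trans eqf; rewrite eH'; exact: equiforced_star.
apply: iff_trans (well_forcedE E) _; apply: iff_trans eqTR _.
have few : {in R, forall v, #|leaf_nbrs E R v| <= 1}.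
  move=> v vR; rewrite leqNgt; apply/negP => L2.
  have /negP := stuck (R :\: (v |: leaf_nbrs E R v)); apply.
  by apply/existsP; exists v; rewrite vR L2 eqxx.
split=> [eqf|]; last exact: equiforced_copies.
by apply: copies_of_matching => //; apply: equiforced_matching.
Qed.
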